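(* Let $\mathcal A$ be a commutative unital C*-algebra and let $\mathcal M$ be a full Hilbert $\mathcal A$-module. Then each 2-local derivation on $\mathrm{End}^*_{\mathcal A}(\mathcal M)$ is a derivation.
   Context: C*-algebras are complex. A Hilbert $\mathcal A$-module is a left $\mathcal A$-module $\mathcal M$ with an $\mathcal A$-valued inner product $\langle\cdot,\cdot\rangle:\mathcal M\times\mathcal M\to\mathcal A$ satisfying, for $\lambda\in\mathbb C$, $a\in\mathcal A$, $x,y,z\in\mathcal M$: $\langle x,x\rangle\ge 0$, and $\langle x,x\rangle=0$ implies $x=0$; $\langle\lambda x+y,z\rangle=\lambda\langle x,z\rangle+\langle y,z\rangle$; $\langle ax,y\rangle=a\langle x,y\rangle$; $\langle x,y\rangle=\langle y,x\rangle^*$; and such that $\mathcal M$ is complete for the norm $\|x\|=\|\langle x,x\rangle\|^{1/2}$. $\mathcal M$ is full if the closed linear span of $\{\langle x,y\rangle:x,y\in\mathcal M\}$ equals $\mathcal A$. A map $T:\mathcal M\to\mathcal M$ is adjointable if there is a map $T^*:\mathcal M\to\mathcal M$ with $\langle Tx,y\rangle=\langle x,T^*y\rangle$ for all $x,y\in\mathcal M$; such a map is automatically bounded and $\mathcal A$-linear. $\mathrm{End}^*_{\mathcal A}(\mathcal M)$ is the C*-algebra (operator norm, composition, involution $T\mapsto T^*$) of all adjointable maps on $\mathcal M$. A derivation on an algebra $\mathcal B$ is a ($\mathbb C$-)linear map $d:\mathcal B\to\mathcal B$ with $d(xy)=d(x)y+xd(y)$ for all $x,y\in\mathcal B$. A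 2-local derivation on $\mathcal B$ is a map $\delta:\mathcal B\to\mathcal B$ (not necessarily linear) such that for each $a,b\in\mathcal B$ there is a derivation $d_{a,b}:\mathcal B\to\mathcal B$ with $\delta(a)=d_{a,b}(a)$ and $\delta(b)=d_{a,b}(b)$. *)

(* Defs.v *)
From HB Require Import structures.
From mathcomp Require Import all_boot all_order all_algebra.
From mathcomp Require Import complex.
From mathcomp Require Import all_classical all_reals all_analysis.

Set Implicit Arguments.
Unset Strict Implicit.
Unset Printing Implicit Defensive.

Import Order.TTheory GRing.Theory Num.Theory.
Import numFieldNormedType.Exports.

Local Open Scope classical_set_scope.
Local Open Scope complex_scope.
Local Open Scope ring_scope.

(* Associative unital algebras over K.  The library's algType excludes the
   zero ring, and a join of GRing.Lmodule with GRing.PzRing clashes with its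
   GRing.Lalgebra.  So the product is a new field here, and the ring structure
   on the carrier is derived from it; thus the C*-algebra 0, and the algebra of
   operators on the module 0, are allowed. *)
HB.mixin Record Lmodule_isPzAlgebra (K : pzRingType) B of GRing.Lmodule K B := {
  amul : B -> B -> B;
  aone : B;
  amulA : associative amul;
  amul1l : left_id aone amul;
  amul1r : right_id aone amul;
  amulDl : left_distributive amul +%R;
  amulDr : right_distributive amul +%R;
  ascalerAl : forall (k : K) (x y : B), k *: amul x y = amul (k *: x) y;
  ascalerAr : forall (k : K) (x y : B), k *: amul x y = amul x (k *: y)
}.

#[short(type="pzAlgType")]
HB.structure Definition PzAlgebra (K : pzRingType) :=
  {B of GRing.Lmodule K B & Lmodule_isPzAlgebra K B}.

HB.instance Definition _ (K : pzRingType) (B : pzAlgType K) :=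
  GRing.Zmodule_isPzRing.Build (PzAlgebra.sort B)
    (@amulA K B) (@amul1l K B) (@amul1r K B) (@amulDl K B) (@amulDr K B).

Section Derivations.
Variables (K : pzRingType) (B : pzAlgType K).

Definition is_derivation (d : B -> B) : Prop :=
  linear d /\ forall x y : B, d (x * y) = d x * y + x * d y.

Definition is_2local_derivation (delta : B -> B) : Prop :=
  forall a b : B, exists d : B -> B,
    [/\ is_derivation d, delta a = d a & delta b = d b].

End Derivations.

(* Unital C*-algebras over the complex numbers R[i].  The norm takes its
   values in R[i] (in the nonnegative reals), as for every normed module of
   the library over R[i]. *)
HB.mixin Record isCStarAlgebra (R : realType) A
    of CompleteNormedModule R[i] A & PzAlgebra R[i] A := {
  star : A -> A;
  starK : involutive star;
  starD : forall x y : A, star (x + y) = star x + star y;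
  starZ : forall (k : R[i]) (x : A), star (k *: x) = k^* *: star x;
  starM : forall x y : A, star (amul x y) = amul (star y) (star x);
  cstar_normM_le : forall x y : A, `|amul x y| <= `|x| * `|y|;
  cstar_norm_starM : forall x : A, `|amul (star x) x| = `|x| ^+ 2
}.

#[short(type="cstarAlgType")]
HB.structure Definition CStarAlgebra (R : realType) :=
  {A of CompleteNormedModule R[i] A & PzAlgebra R[i] A & isCStarAlgebra R A}.

HB.instance Definition _ (R : realType) (A : cstarAlgType R) :=
  GRing.PzRing.copy (CStarAlgebra.sort A) (A : pzAlgType R[i]).

HB.mixin Record CStarAlgebra_isCommutative (R : realType) A
    of CStarAlgebra R A := {
  amulC : forall x y : A, amul x y = amul y x
}.

#[short(type="comCStarAlgType")]
HB.structure Definition ComCStarAlgebra (R : realType) :=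
  {A of CStarAlgebra R A & CStarAlgebra_isCommutative R A}.

HB.instance Definition _ (R : realType) (A : comCStarAlgType R) :=
  GRing.PzRing.copy (ComCStarAlgebra.sort A) (A : pzAlgType R[i]).
HB.instance Definition _ (R : realType) (A : comCStarAlgType R) :=
  GRing.PzRing_hasCommutativeMul.Build (ComCStarAlgebra.sort A) (@amulC R A).

Section Positivity.
Variables (R : realType) (A : cstarAlgType R).

Definition invertible (a : A) : Prop := exists b : A, a * b = 1 /\ b * a = 1.

Definition spectrum (a : A) : set R[i] :=
  [set k | ~ invertible (k *: (1 : A) - a)].

(* In R[i], 0 <= k says that k is real and nonnegative. *)
Definition cstar_nonneg (a : A) : Prop :=
  star a = a /\ forall k, spectrum a k -> 0 <= k.

End Positivity.

(* Left Hilbert A-modules.  The canonical *: on M is the scaling by complex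
   numbers; the action of A is hmact.  The norm and the completeness are those
   of the underlying normed module, and hm_normE forces the norm to be
   `|<x, x>| ^ (1/2). *)
HB.mixin Record isHilbertModule (R : realType) (A : cstarAlgType R) M
    of CompleteNormedModule R[i] M := {
  hmact : A -> M -> M;
  hmactDl : forall (a b : A) (x : M), hmact (a + b) x = hmact a x + hmact b x;
  hmactDr : forall (a : A) (x y : M), hmact a (x + y) = hmact a x + hmact a y;
  hmactZl : forall (k : R[i]) (a : A) (x : M),
    hmact (k *: a) x = k *: hmact a x;
  hmactZr : forall (k : R[i]) (a : A) (x : M),
    hmact a (k *: x) = k *: hmact a x;
  hmactM : forall (a b : A) (x : M), hmact (a * b) x = hmact a (hmact b x);
  hmact1 : forall x : M, hmact 1 x = x;
  hmip : M -> M -> A;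
  hmip_ge0 : forall x : M, cstar_nonneg (hmip x x);
  hmip_eq0 : forall x : M, hmip x x = 0 -> x = 0;
  hmipDZl : forall (k : R[i]) (x y z : M),
    hmip (k *: x + y) z = k *: hmip x z + hmip y z;
  hmip_act : forall (a : A) (x y : M), hmip (hmact a x) y = a * hmip x y;
  hmip_star : forall x y : M, hmip x y = star (hmip y x);
  hm_normE : forall x : M, `|x| ^+ 2 = `|hmip x x|
}.

#[short(type="hilbertModType")]
HB.structure Definition HilbertModule (R : realType) (A : cstarAlgType R) :=
  {M of CompleteNormedModule R[i] M & isHilbertModule R A M}.

Section HilbertModuleTheory.
Variables (R : realType) (A : cstarAlgType R) (M : hilbertModType A).
Implicit Types (T S : M -> M) (x y z : M).

Local Notation "'<| x , y |>" := (hmip x y : A).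

Definition hilbert_full : Prop :=
  closure [set a : A | exists n (c : 'I_n -> R[i]) (x y : 'I_n -> M),
    a = \sum_(i < n) c i *: '<| x i, y i |>] = setT.

Definition adjointable : {pred M -> M} :=
  fun T => `[< exists S, forall x y, '<| T x, y |> = '<| x, S y |> >].

Lemma adjointableP T :
  reflect (exists S, forall x y, '<| T x, y |> = '<| x, S y |>)
          (T \in adjointable).
Proof. exact: asboolP. Qed.

Lemma hmipDl x y z : '<| x + y, z |> = '<| x, z |> + '<| y, z |>.
Proof. by rewrite -[x]scale1r hmipDZl !scale1r. Qed.

Lemma hmip0l z : '<| 0, z |> = 0.
Proof. by apply: (@addrI _ '<| 0, z |>); rewrite -hmipDl !addr0. Qed.

Lemma hmipZl k x z : '<| k *: x, z |> = k *: '<| x, z |>.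
Proof. by rewrite -[k *: x]addr0 hmipDZl hmip0l addr0. Qed.

Lemma hmipDr x y z : '<| x, y + z |> = '<| x, y |> + '<| x, z |>.
Proof.
by rewrite [LHS]hmip_star hmipDl starD -!hmip_star.
Qed.

Lemma hmipZr k x z : '<| x, k *: z |> = k^* *: '<| x, z |>.
Proof. by rewrite [LHS]hmip_star hmipZl starZ -hmip_star. Qed.

Lemma hmip_injl x y : (forall z, '<| x, z |> = '<| y, z |>) -> x = y.
Proof.
move=> xy; apply/eqP; rewrite -subr_eq0; apply/eqP/(@hmip_eq0 _ A).
by rewrite hmipDl xy -hmipDl subrr hmip0l.
Qed.

Lemma adjointable_linear T : T \in adjointable -> linear T.
Proof.
move=> /adjointableP[S TS] k x y; apply: hmip_injl => z.
by rewrite hmipDZl !TS hmipDZl.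
Qed.

Lemma adjointable1 : idfun \in adjointable.
Proof. by apply/adjointableP; exists idfun. Qed.

Lemma adjointable_comp T1 T2 :
  T1 \in adjointable -> T2 \in adjointable -> T1 \o T2 \in adjointable.
Proof.
move=> /adjointableP[S1 h1] /adjointableP[S2 h2]; apply/adjointableP.
by exists (S2 \o S1) => x y /=; rewrite h1 h2.
Qed.

Lemma adjointable_submod : submod_closed adjointable.
Proof.
split.
  by apply/adjointableP; exists (fun=> 0) => x y; rewrite hmip0l hmip_star hmip0l
    -(hmip0l 0) -hmip_star hmip0l.
move=> k T1 T2 /adjointableP[S1 h1] /adjointableP[S2 h2]; apply/adjointableP.
exists (fun y => k^* *: S1 y + S2 y) => x y.
by rewrite hmipDZl h1 h2 hmipDr hmipZr conjCK.
Qed.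

HB.instance Definition _ :=
  GRing.isSubmodClosed.Build R[i] (M -> M) adjointable adjointable_submod.

Record adjEnd := AdjEnd { adjEnd_fun :> M -> M; _ : adjEnd_fun \in adjointable }.

HB.instance Definition _ := [isSub for adjEnd_fun].
HB.instance Definition _ := [Choice of adjEnd by <:].
(* Pointwise addition and complex scaling of maps M -> M *)
HB.instance Definition _ := [SubChoice_isSubLmodule of adjEnd by <:].

Definition adjEnd_one : adjEnd := AdjEnd adjointable1.
Definition adjEnd_mul (T1 T2 : adjEnd) : adjEnd :=
  AdjEnd (adjointable_comp (valP T1) (valP T2)).

Lemma adjEnd_linear (T : adjEnd) : linear T.
Proof. exact: adjointable_linear (valP T). Qed.

Lemma adjEnd_funD (T1 T2 : adjEnd) x : (T1 + T2) x = T1 x + T2 x.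
Proof. by []. Qed.

Lemma adjEnd_funZ k (T : adjEnd) x : (k *: T) x = k *: T x.
Proof. by []. Qed.

Lemma adjEndP (T1 T2 : adjEnd) : T1 =1 T2 -> T1 = T2.
Proof. by move=> T12; apply/val_inj/funext. Qed.

Lemma adjEnd_mulA : associative adjEnd_mul.
Proof. by move=> T1 T2 T3; apply: adjEndP. Qed.

Lemma adjEnd_mul1 : left_id adjEnd_one adjEnd_mul.
Proof. by move=> T; apply: adjEndP. Qed.

Lemma adjEnd_mulr1 : right_id adjEnd_one adjEnd_mul.
Proof. by move=> T; apply: adjEndP. Qed.

Lemma adjEnd_mulDl : left_distributive adjEnd_mul +%R.
Proof. by move=> T1 T2 T3; apply: adjEndP. Qed.

Lemma adjEnd_mulDr : right_distributive adjEnd_mul +%R.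
Proof.
move=> T1 T2 T3; apply: adjEndP => x.
by have := adjEnd_linear T1 1 (T2 x) (T3 x); rewrite !scale1r.
Qed.

Lemma adjEnd_scalerAl (k : R[i]) (T1 T2 : adjEnd) :
  k *: adjEnd_mul T1 T2 = adjEnd_mul (k *: T1) T2.
Proof. exact: adjEndP. Qed.

Lemma adjEnd_scalerAr (k : R[i]) (T1 T2 : adjEnd) :
  k *: adjEnd_mul T1 T2 = adjEnd_mul T1 (k *: T2).
Proof.
apply: adjEndP => x.
have T10 : T1 0 = 0.
  by have := adjEnd_linear T1 (-1) 0 0; rewrite scaler0 addr0 scaleN1r addNr.
by have := adjEnd_linear T1 k (T2 x) 0; rewrite T10 !addr0.
Qed.

HB.instance Definition _ := Lmodule_isPzAlgebra.Build R[i] adjEnd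
  adjEnd_mulA adjEnd_mul1 adjEnd_mulr1 adjEnd_mulDl adjEnd_mulDr
  adjEnd_scalerAl adjEnd_scalerAr.
HB.instance Definition _ := GRing.PzRing.copy adjEnd (adjEnd : pzAlgType R[i]).

Lemma adjEnd_funM (T1 T2 : adjEnd) x : (T1 * T2) x = T1 (T2 x).
Proof. by []. Qed.

Lemma adjEnd_fun1 x : (1 : adjEnd) x = x.
Proof. by []. Qed.

End HilbertModuleTheory.

Arguments hilbert_full {R A} M.
Arguments adjointable {R A} M _.
Arguments adjEnd {R A} M.

(* Main.v *)
(** A derivation of a commutative C*-algebra A vanishes: for a self-adjoint and
    t real, the Jordan decomposition a - t = u^2 - v^2 shows that d a is small
    where a is close to t, for every t.  Hence a derivation d of End*(M) kills the
    centre A.  Choosing X_i, Y_i in M with sum_i <X_i, Y_i> = 1, which fullness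
    allows, the map D z = sum_i d (theta_{z,Y_i}) X_i is then A-linear and
    adjointable, and d = [D, -].

    Let delta be a 2-local derivation.  For a rank one operator
    p = theta_{x,y}, the trace identity tr ([D, a] p) = - tr (a [D, p]) shows
    that <delta (a) x, y> = tr (delta (a) p) = - tr (a delta (p)) is additive in
    a.  No trace is constructed: it suffices that <[E, a] x, y> = 0 whenever E
    commutes with p, which follows from A being reduced.  So delta is linear,
    and it is a Jordan derivation because it agrees with a derivation at a and
    a^2.  Jordan derivations of 2-torsion free semiprime rings are derivations
    (Bresar); the proof is short here since delta commutes with multiplication
    by central elements. *)
Require Import Defs.
From mathcomp Require Import all_boot all_order all_algebra.
From mathcomp Require Import complex ring lra.
From mathcomp Require Import all_classical all_reals all_analysis.
From Stdlib Require Ncring Ncring_tac.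

Set Implicit Arguments.
Unset Strict Implicit.
Unset Printing Implicit Defensive.

Import Order.TTheory GRing.Theory Num.Theory.
Import numFieldNormedType.Exports.

Local Open Scope classical_set_scope.
Local Open Scope complex_scope.
Local Open Scope ring_scope.

(** * The norm of a commutative C*-algebra *)

Section CStar.
Variables (R : realType) (A : comCStarAlgType R).
Implicit Types (a b c h k p q x y : A) (r s t : R).

Lemma real_complexD s t : (s + t)%:C = s%:C + t%:C :> R[i]. Proof. exact: rmorphD. Qed.

Lemma real_complexM s t : (s * t)%:C = s%:C * t%:C :> R[i]. Proof. exact: rmorphM. Qed.

(** [|x|] takes values in [R[i]]; its real part loses nothing, by [nrmE], and is accessible to [lra]
    and [nra]. *)
Definition nrm x : R := complex.Re `|x|.

Lemma nrmE x : `|x| = (nrm x)%:C.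
Proof. by rewrite /nrm RRe_real // ger0_real. Qed.

Lemma nrm_ge0 x : 0 <= nrm x.
Proof. by rewrite -lecR -nrmE -[0%:C]/(0 : R[i]) normr_ge0. Qed.

Lemma nrmD x y : nrm (x + y) <= nrm x + nrm y.
Proof.
rewrite -lecR real_complexD -!nrmE.
by rewrite ler_normD. Qed.

Lemma nrmN x : nrm (- x) = nrm x.
Proof. by rewrite /nrm normrN. Qed.

Lemma nrmM x y : nrm (x * y) <= nrm x * nrm y.
Proof. by rewrite -lecR real_complexM -!nrmE; exact: cstar_normM_le. Qed.

Lemma nrm_star x : nrm (star x * x) = nrm x ^+ 2.
Proof.
by apply: complexI; rewrite expr2 real_complexM -!nrmE -expr2;
  exact: cstar_norm_starM.
Qed.

Lemma nrm0 : nrm 0 = 0.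
Proof. by rewrite /nrm normr0. Qed.

Lemma nrm_eq0 x : nrm x = 0 -> x = 0.
Proof. by move=> x0; apply/normr0_eq0; rewrite nrmE x0. Qed.

(** Real scalars enter as ring elements, so that [ring] handles identities mixing them with elements
    of [A]. *)
Definition creal t : A := t%:C *: (1 : A).

Lemma scalecE (z : R[i]) x : z *: x = (z *: (1 : A)) * x.
Proof. by have := ascalerAl z (1 : A) x; rewrite amul1l. Qed.

Lemma crealD s t : creal (s + t) = creal s + creal t.
Proof. by rewrite /creal real_complexD scalerDl. Qed.

Lemma crealN t : creal (- t) = - creal t.
Proof. by rewrite /creal rmorphN scaleNr. Qed.

Lemma crealM s t : creal (s * t) = creal s * creal t.
Proof. by rewrite /creal real_complexM -scalerA scalecE. Qed.

Lemma creal1 : creal 1 = 1.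
Proof. by rewrite /creal rmorph1 scale1r. Qed.

Lemma nrm_crealM t x : nrm (creal t * x) = `|t| * nrm x.
Proof.
by rewrite /nrm -scalecE normrZ normc_def /= expr0n addr0 sqrtr_sqr nrmE -real_complexM.
Qed.

Lemma starMr x y : star (x * y) = star x * star y.
Proof. by rewrite mulrC; exact: starM. Qed.

Lemma star1 : star (1 : A) = 1.
Proof. by have := starMr (star 1) 1; rewrite mulr1 starK mul1r. Qed.

Lemma star0 : star (0 : A) = 0.
Proof. by apply: (addrI (star (0 : A))); rewrite -starD !addr0. Qed.

Lemma starN x : star (- x) = - star x.
Proof. by apply: (addrI (star x)); rewrite -starD !subrr star0. Qed.

Lemma star_creal t : star (creal t) = creal t.
Proof.
rewrite /creal starZ star1 conj_Creal //; apply/complex_realP; by exists t.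
Qed.

Lemma nrm1_le : nrm 1 <= 1.
Proof.
have := nrm_star 1; rewrite star1 mulr1 => h.
by have := nrm_ge0 1; nra.
Qed.

Lemma sqr_sa_eq0 x : star x = x -> x * x = 0 -> x = 0.
Proof.
move=> sx xx; apply: nrm_eq0; have := nrm_star x; rewrite sx xx nrm0.
by move=> h; apply/eqP; rewrite -sqrf_eq0 -h.
Qed.

(** By commutativity [star x * x] is self-adjoint with square zero, so the C*-identity kills it, and
    then [x]. *)
Lemma reduced x : x * x = 0 -> x = 0.
Proof.
move=> xx; have h : star x * x = 0.
  by apply: sqr_sa_eq0; rewrite ?starMr ?starK; [ring | rewrite mulrACA xx mulr0].
apply: nrm_eq0; have := nrm_star x; rewrite h nrm0.
by move=> h'; apply/eqP; rewrite -sqrf_eq0 -h'.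
Qed.

(** The majorant [v] is nondecreasing and bounded, so [u] is Cauchy and completeness gives the
    limit. *)
Lemma majorant_cvg (u : nat -> A) (v : nat -> R) (l : R) :
  (forall n, nrm (u n.+1 - u n) <= v n.+1 - v n) -> (forall n, v n <= l) ->
  exists y, forall e, 0 < e -> exists N, forall n, (N <= n)%N -> nrm (u n - y) <= e.
Proof.
move=> uv vl.
have uvD m n : nrm (u (m + n)%N - u m) <= v (m + n)%N - v m.
  elim: n => [|n IH]; first by rewrite addn0 !subrr nrm0.
  rewrite addnS; have := nrmD (u (m + n).+1 - u (m + n)%N) (u (m + n)%N - u m).
  rewrite addrA subrK => /le_trans; apply.
  by have := lerD (uv (m + n)%N) IH; rewrite addrA subrK.
have vnd : nondecreasing_seq v.
  apply/nondecreasing_seqP => n; rewrite -subr_ge0.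
  exact: le_trans (nrm_ge0 _) (uv n).
have vC e : 0 < e -> exists N, forall n, (N <= n)%N -> v n - v N <= e.
  move=> e0; have hs : has_sup (range v).
    by split; [exists (v 0%N); exists 0%N | exists l => _ [n _ <-]].
  have [_ [N _ <-] hN] := sup_adherent e0 hs.
  exists N => n _; have : v n <= sup (range v).
    by apply: sup_ubound; [case: hs | exists n].
  move: hN; lra.
have uC : cvg (u @ \oo).
  apply/cauchy_cvgP/cauchy_exP => z z0.
  have zE : z = (complex.Re z)%:C by rewrite RRe_real // gtr0_real.
  have e0 : 0 < complex.Re z by move: z0; rewrite {1}zE -[0]/(0%:C) ltcR.
  have [N hN] := vC (complex.Re z / 2) ltac:(lra).
  exists (u N); exists N => // n /= Nn.
  rewrite -ball_normE /ball_ /= -normrN opprB zE nrmE ltcR.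
  have := uvD N (n - N)%N; rewrite subnKC //; have := hN n Nn; lra.
exists (lim (u @ \oo)) => e e0.
move/cvgrPdist_le : uC => /(_ e%:C) []; first by rewrite -[0]/(0%:C) ltcR.
move=> N _ hN; exists N => n Nn; have := hN n Nn.
by rewrite /= -normrN opprB nrmE lecR.
Qed.

End CStar.

(** * Positive elements *)

Section CStarOrder.
Variables (R : realType) (A : comCStarAlgType R).
Implicit Types (a b c h k p q u v x y : A) (e r s t : R).

Local Notation "r %:CA" := (creal A r) (at level 1, format "r %:CA").

Lemma starB x y : star (x - y) = star x - star y.
Proof. by rewrite starD starN. Qed.

Lemma nrm_starE x : nrm (star x) = nrm x.
Proof.
have le y : nrm y <= nrm (star y).
  have h := nrm_star y; have h' := nrmM (star y) y.
  have [y0|y0] := eqVneq (nrm y) 0; first by rewrite y0 nrm_ge0.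
  have y1 : 0 < nrm y by rewrite lt_neqAle eq_sym y0 nrm_ge0.
  by rewrite -(ler_pM2r y1) -expr2 -h.
by apply/eqP; rewrite eq_le le -{2}[x]starK le.
Qed.

Definition cimag : A := 'i *: (1 : A).

Lemma star_cimag : star cimag = - cimag.
Proof. by rewrite /cimag starZ star1 conjCi scaleNr. Qed.

Lemma cimag_sqr : cimag * cimag = - 1.
Proof. by rewrite -scalecE scalerA -expr2 sqrCi scaleN1r. Qed.

Lemma creal_half : (1/2)%:CA + (1/2)%:CA = 1 :> A.
Proof. by rewrite -crealD -(@creal1 R A); congr (creal _ _); lra. Qed.

Lemma creal_invr r : r != 0 -> r%:CA * r^-1%:CA = 1 :> A.
Proof. by move=> r0; rewrite -crealM mulfV // creal1. Qed.

(* y is the limit of the iteration y |-> (x + y^2) / 2 from 0, dominated by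
   the scalar iteration s |-> (1 + s^2) / 2, which stays in [0, 1]. *)
Lemma sqrt_1B x : nrm x <= 1 -> exists y,
  [/\ nrm y <= 1, (1 - y) * (1 - y) = 1 - x & star x = x -> star y = y].
Proof.
move=> x1; pose F y := (1/2)%:CA * (x + y * y); pose f (s : R) := (1 + s * s) / 2.
pose u n := iter n F 0; pose v n := iter n f 0.
have v01 n : 0 <= v n <= 1.
  elim: n => [|n /andP[h0 h1]]; rewrite /= ?lexx ?ler01 // /f.
  by apply/andP; split; nra.
have uv n : nrm (u n) <= v n.
  elim: n => [|n IH]; first by rewrite /= nrm0.
  rewrite /= /F nrm_crealM ger0_norm; last lra.
  have := nrmD x (u n * u n); have := nrmM (u n) (u n); have := nrm_ge0 (u n).
  have := v01 n; rewrite /f -/(u n) -/(v n); nra.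
have step n : nrm (u n.+1 - u n) <= v n.+1 - v n.
  elim: n => [|n IH].
    rewrite /= /F /f !mul0r !addr0 subr0 nrm_crealM ger0_norm; last lra.
    move: x1; lra.
  have -> : u n.+2 - u n.+1 = (1/2)%:CA * ((u n.+1 - u n) * (u n.+1 + u n)).
    by rewrite -[LHS]/(F (u n.+1) - F (u n)) /F; ring.
  have -> : v n.+2 - v n.+1 = 1/2 * ((v n.+1 - v n) * (v n.+1 + v n)).
    by rewrite -[LHS]/(f (v n.+1) - f (v n)) /f; field.
  rewrite nrm_crealM ger0_norm; last lra.
  apply: ler_wpM2l; first lra.
  apply: le_trans (nrmM _ _) _; apply: ler_pM; rewrite ?nrm_ge0 //.
  exact: le_trans (nrmD _ _) (lerD (uv _) (uv _)).
have [y uy] := majorant_cvg step (fun n => proj2 (andP (v01 n))).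
have y1 : nrm y <= 1.
  apply/ler_addgt0Pr => e e0; have [N hN] := uy e e0; have := hN N (leqnn N).
  have := nrmD (u N) (- (u N - y)); rewrite nrmN opprB addrC subrK.
  by have := uv N; have := v01 N; lra.
exists y; split => //.
- apply/eqP; rewrite -subr_eq0; apply/eqP/nrm_eq0/eqP.
  rewrite eq_le nrm_ge0 andbT; apply/ler_addgt0Pr => e e0.
  have [N hN] := uy (e / 4) ltac:(lra).
  (* Uses [u N.+1 + u N.+1 = x + u N * u N]. As [nrm (u N + y) <= 2], the error is at most
     [4 * (e / 4)]. *)
  have -> : (1 - y) * (1 - y) - (1 - x) =
      (u N.+1 - y) + (u N.+1 - y) - (u N - y) * (u N + y).
    transitivity ((1/2)%:CA * (x + u N * u N) + (1/2)%:CA * (x + u N * u N) - y - y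
      - (u N - y) * (u N + y)); last by rewrite [u N.+1]/= -/(u N) /F; ring.
    by rewrite -mulrDl creal_half; ring.
  have := nrmD (u N.+1 - y + (u N.+1 - y)) (- ((u N - y) * (u N + y))).
  have := nrmD (u N.+1 - y) (u N.+1 - y); rewrite nrmN.
  have := nrmM (u N - y) (u N + y); have := nrmD (u N) y.
  have := hN N (leqnn N); have := hN N.+1 (leqnSn N).
  have := uv N; have := v01 N; have := nrm_ge0 (u N - y); have := nrm_ge0 (u N + y).
  nra.
- move=> sx; have su n : star (u n) = u n.
    by elim: n => [|n IH]; rewrite /= ?star0 // /F starMr star_creal starD starMr sx IH.
  apply/eqP; rewrite -subr_eq0; apply/eqP/nrm_eq0/eqP.
  rewrite eq_le nrm_ge0 andbT; apply/ler_addgt0Pr => e e0.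
  have [N hN] := uy (e / 2) ltac:(lra).
  have -> : star y - y = (u N - y) - star (u N - y) by rewrite starB su; ring.
  have := nrmD (u N - y) (- star (u N - y)); rewrite nrmN nrm_starE.
  by have := hN N (leqnn N); lra.
Qed.

(* Positivity is encoded as being the square of a self-adjoint element, so
   that no spectral theory is needed. *)
Definition pos h := exists2 k, star k = k & h = k * k.

Lemma pos_sa h : pos h -> star h = h.
Proof. by move=> [k sk ->]; rewrite starMr sk. Qed.

Lemma pos1B x : star x = x -> nrm x <= 1 -> pos (1 - x).
Proof.
move=> sx /sqrt_1B[y [_ <- /(_ sx) sy]].
by exists (1 - y); rewrite ?starB ?star1 ?sy.
Qed.

(* p + i k is unitary. *)
Lemma nrm_circle p k : star p = p -> star k = k -> p * p + k * k = 1 -> nrm p <= 1.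
Proof.
move=> sp sk pk; have sj := star_cimag; have jj := cimag_sqr; set j := cimag in sj jj.
have u1 : star (p + j * k) * (p + j * k) = 1.
  rewrite starD starMr sp sk sj -pk.
  transitivity (p * p - (j * j) * (k * k)); first by ring.
  by rewrite jj mulN1r opprK.
have nu : nrm (p + j * k) <= 1.
  have := nrm_star (p + j * k); rewrite u1.
  by have := nrm1_le A; have := nrm_ge0 (p + j * k); nra.
have -> : p = (1/2)%:CA * (p + j * k + star (p + j * k)).
  rewrite starD starMr sp sk sj; transitivity (((1/2)%:CA + (1/2)%:CA) * p).
    by rewrite creal_half mul1r.
  by ring.
rewrite nrm_crealM ger0_norm; last lra.
have := nrmD (p + j * k) (star (p + j * k)); rewrite nrm_starE; lra.
Qed.

(** Write [1 - a * a] as [k * k] with [k] self-adjoint; [nrm_circle] bounds [k] because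
    [k * k + a * a = 1]. *)
Lemma nrm_1B_sqr a : star a = a -> nrm a <= 1 -> nrm (1 - a * a) <= 1.
Proof.
move=> sa a1.
have [||k sk kE] := @pos1B (a * a).
- by rewrite starMr sa.
- by have := nrmM a a; have := nrm_ge0 a; nra.
have k1 : nrm k <= 1 by apply: (@nrm_circle k a) => //; rewrite -kE subrK.
by rewrite kE; have := nrmM k k; have := nrm_ge0 k; nra.
Qed.

Lemma posM h k : pos h -> pos k -> pos (h * k).
Proof.
by move=> [p sp ->] [q sq ->]; exists (p * q); [rewrite starMr sp sq | ring].
Qed.

Lemma pos_creal r : 0 <= r -> pos r%:CA.
Proof.
by move=> r0; exists (Num.sqrt r)%:CA; rewrite ?star_creal // -crealM -expr2 sqr_sqrtr.
Qed.

Lemma posZ r h : 0 <= r -> pos h -> pos (r%:CA * h).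
Proof. by move=> r0; apply: posM; apply: pos_creal. Qed.

Lemma posZV r h : 0 < r -> pos (r%:CA * h) -> pos h.
Proof.
move=> r0 hh; rewrite -[h]mul1r -(@creal_invr r) ?gt_eqF //.
by rewrite [_%:CA * _]mulrC -mulrA; apply: posZ => //; rewrite invr_ge0 ltW.
Qed.

(** Scale [a], [b] to [a'], [b'] of norm at most 1. Then [1 - a' * a'] and [1 - b' * b'] lie in the
    unit ball, hence so does their mean [x], and [pos1B] applies to [1 - x], the mean of the two
    squares. *)
Lemma posD h k : pos h -> pos k -> pos (h + k).
Proof.
move=> [a sa ->] [b sb ->].
pose s := 1 + nrm a + nrm b; have a0 := nrm_ge0 a; have b0 := nrm_ge0 b.
have s0 : 0 < s by rewrite /s; lra.
have si : 0 < s^-1 by rewrite invr_gt0.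
have H c : star c = c -> nrm c <= s -> nrm (1 - (s^-1)%:CA * c * ((s^-1)%:CA * c)) <= 1.
  move=> sc cs; apply: nrm_1B_sqr; first by rewrite starMr star_creal sc.
  by rewrite nrm_crealM gtr0_norm // ler_pdivrMl // mulr1.
have Ha := H a sa ltac:(rewrite /s; lra); have Hb := H b sb ltac:(rewrite /s; lra).
apply: (@posZV (s^-1 * s^-1 * (1/2))); first by rewrite !mulr_gt0 //; lra.
rewrite (@crealM R A (s^-1 * s^-1)) (@crealM R A s^-1).
pose a' := (s^-1)%:CA * a; pose b' := (s^-1)%:CA * b.
pose x := (1/2)%:CA * ((1 - a' * a') + (1 - b' * b')).
have -> : (s^-1)%:CA * (s^-1)%:CA * (1/2)%:CA * (a * a + b * b) = 1 - x.
  transitivity ((1/2)%:CA + (1/2)%:CA - x); last by rewrite creal_half.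
  by rewrite /x /a' /b'; ring.
apply: pos1B.
  by rewrite /x /a' /b' !(starMr, starD, starN, star1, star_creal) sa sb.
rewrite /x nrm_crealM ger0_norm; last lra.
have := nrmD (1 - a' * a') (1 - b' * b'); move: Ha Hb; rewrite -/a' -/b'; lra.
Qed.

Lemma nrm_pos_le1 h : pos h -> pos (1 - h) -> nrm h <= 1.
Proof.
move=> [p sp ->] [q sq qE].
have p1 : nrm p <= 1 by apply: (@nrm_circle p q) => //; rewrite -qE addrC subrK.
by have := nrmM p p; have := nrm_ge0 p; nra.
Qed.

Lemma pos_anti h : pos h -> pos (- h) -> h = 0.
Proof.
move=> h0 h1; apply/nrm_eq0/eqP; rewrite eq_le nrm_ge0 andbT.
apply/ler_addgt0Pr => e e0; rewrite add0r.
have ei : 0 < e^-1 by rewrite invr_gt0.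
have : nrm ((e^-1)%:CA * h) <= 1.
  apply: nrm_pos_le1; first by apply: posZ (ltW _) _.
  rewrite -mulrN; apply: posD; last by apply: posZ (ltW _) _.
  by rewrite -(@creal1 R A); apply: pos_creal.
by rewrite nrm_crealM gtr0_norm // ler_pdivrMl // mulr1.
Qed.

Lemma pos_sub_sa r c : 0 < r -> star c = c -> nrm c <= r -> pos (r%:CA - c).
Proof.
move=> r0 sc cr; have ri : 0 < r^-1 by rewrite invr_gt0.
apply: (@posZV r^-1) => //; rewrite mulrBr [_ * r%:CA]mulrC creal_invr ?gt_eqF //.
apply: pos1B; first by rewrite starMr sc star_creal.
by rewrite nrm_crealM gtr0_norm // ler_pdivrMl // mulr1.
Qed.

(** The modulus of [c]: rescale to c' = c / s of norm at most 1 and apply [sqrt_1B] to 1 - c'^2; the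
    root [1 - y] is positive since [nrm y <= 1]. *)
Lemma abs_sa c : star c = c -> exists2 w, pos w & w * w = c * c.
Proof.
move=> sc; pose s := 1 + nrm c; have c0 := nrm_ge0 c.
have s0 : 0 < s by rewrite /s; lra.
have si : 0 < s^-1 by rewrite invr_gt0.
have sc' : star ((s^-1)%:CA * c) = (s^-1)%:CA * c by rewrite starMr sc star_creal.
have := @nrm_1B_sqr ((s^-1)%:CA * c) sc'.
rewrite nrm_crealM gtr0_norm // ler_pdivrMl // mulr1 => /(_ ltac:(rewrite /s; lra)).
move=> /sqrt_1B[y [y1 yE sy]].
exists (s%:CA * (1 - y)).
  apply: posZ (ltW s0) _; apply: pos1B => //.
  by apply: sy; rewrite starB star1 starMr sc'.
transitivity (s%:CA * s%:CA * ((1 - y) * (1 - y))); first by ring.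
rewrite yE; transitivity (s%:CA * (s^-1)%:CA * (s%:CA * (s^-1)%:CA) * (c * c)).
  by ring.
by rewrite creal_invr ?gt_eqF // !mul1r.
Qed.

(** With [w] the modulus of [u] and [n = w - u], orthogonality gives [w * v = 0] and (u + v) n^2 = -
    w n^2. So w n^2 and its opposite are both positive, hence 0; this forces [n = 0], i.e.
    [u = w]. *)
Lemma pos_orthogonal u v :
  star u = u -> u * v = 0 -> pos (u + v) -> pos u.
Proof.
move=> su uv puv; have [w pw wE] := abs_sa su.
have wv : w * v = 0.
  by apply: reduced; rewrite mulrACA wE mulrACA uv mul0r.
pose n := w - u.
have nn : w * (n * n) = 0.
  have sn : star n = n by rewrite /n starB su (pos_sa pw).
  have pn : pos (n * n) by exists n.
  apply: pos_anti; first exact: posM.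
  have -> : - (w * (n * n)) = (u + v) * (n * n); last exact: posM.
  have -> : (u + v) * (n * n) = u * w * n - u * u * n + n * (w * v - u * v).
    by rewrite /n; ring.
  rewrite wv uv subr0 mulr0 addr0 -wE /n.
  by ring.
have wn : w * n = 0.
  by apply: reduced; rewrite mulrACA -[w * w * _]mulrA nn mulr0.
have : n * n = 0.
  have -> : n * n = w * n + w * n - (w * w - u * u) by rewrite /n; ring.
  by rewrite wn wE subrr addr0 subr0.
by move=> /reduced/eqP; rewrite subr_eq0 => /eqP <-.
Qed.

(** For the modulus [w] of [c], the elements [w + c] and [w - c] are orthogonal with positive sum,
    so both are positive; [p] and [q] are square roots of their halves. *)
Lemma jordan_dec c : star c = c -> exists p q,
  [/\ star p = p, star q = q, p * q = 0 & c = p * p - q * q].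
Proof.
move=> sc; have [w pw wE] := abs_sa sc.
have uv0 : (w + c) * (w - c) = 0.
  by transitivity (w * w - c * c); [ring | rewrite wE subrr].
have pww : pos (w + w) by apply: posD.
have sw := pos_sa pw.
have [p sp pE] : pos ((1/2)%:CA * (w + c)).
  apply: posZ; first lra.
  apply: (@pos_orthogonal _ (w - c)) => //; first by rewrite starD sw sc.
  by have -> : w + c + (w - c) = w + w by ring.
have [q sq qE] : pos ((1/2)%:CA * (w - c)).
  apply: posZ; first lra.
  apply: (@pos_orthogonal _ (w + c)); first by rewrite starB sw sc.
    by rewrite mulrC.
  by have -> : w - c + (w + c) = w + w by ring.
exists p, q; split => //; last first.
  rewrite -pE -qE -mulrBr; transitivity (((1/2)%:CA + (1/2)%:CA) * c); last by ring.
  by rewrite creal_half mul1r.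
apply: reduced; rewrite mulrACA -pE -qE mulrACA uv0 mulr0 //.
Qed.

End CStarOrder.

(** * Derivations of a commutative C*-algebra *)

Section CommutativeDerivation.
Variables (R : realType) (A : comCStarAlgType R).
Implicit Types (a b c q u v x y : A) (e r s t : R).

Local Notation "r %:CA" := (creal A r) (at level 1, format "r %:CA").

(** The product is the sum of the squares of the real and imaginary parts of [b]. *)
Lemma pos_mul_star b : pos (b * star b).
Proof.
have sj := star_cimag A; have jj := cimag_sqr A; set j := cimag A in sj jj.
have hh := creal_half A; set hf := (1/2)%:CA in hh.
have shf : star hf = hf by rewrite star_creal.
have -> : b * star b = (hf * (b + star b)) * (hf * (b + star b)) +
   (hf * (j * (star b - b))) * (hf * (j * (star b - b))).
  transitivity ((hf + hf) * (hf + hf) * (b * star b)).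
    by rewrite hh !mul1r.
  transitivity (hf * hf * ((b + star b) * (b + star b) +
    j * j * ((star b - b) * (star b - b)))); last by ring.
  by rewrite jj; ring.
apply: posD.
  exists (hf * (b + star b)); rewrite // !(starMr, starD) shf starK.
  by rewrite [star b + b]addrC.
exists (hf * (j * (star b - b))); rewrite // !(starMr, starB) shf sj starK.
by ring.
Qed.

Lemma pos_eq0_of_le q : pos q -> (forall e, 0 < e -> pos (e%:CA - q)) -> q = 0.
Proof.
move=> q0 qe; apply/nrm_eq0/eqP; rewrite eq_le nrm_ge0 andbT.
apply/ler_addgt0Pr => e e0; rewrite add0r.
have ei : 0 < e^-1 by rewrite invr_gt0.
have : nrm ((e^-1)%:CA * q) <= 1.
  apply: nrm_pos_le1; first exact: posZ (ltW _) _.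
  rewrite -(@creal_invr _ A e) ?gt_eqF // mulrC -mulrBr.
  by apply: posZ (ltW _) _ => //; exact: qe.
by rewrite nrm_crealM gtr0_norm // ler_pdivrMl // mulr1.
Qed.

(* If q were nonzero, the supremum T of the t with q (a - t) >= 0, i.e. the
   minimum of a on the support of q, would violate the hypothesis at t = T. *)
Lemma empty_local_spectrum a q : star a = a -> pos q ->
  (forall t, exists2 e, 0 < e & pos (q * ((a - t%:CA) * (a - t%:CA) - e%:CA))) ->
  q = 0.
Proof.
move=> sa q0 hq; apply: contrapT => qn0.
pose N := 1 + nrm a; have a0 := nrm_ge0 a; have N0 : 0 < N by rewrite /N; lra.
have pNa : pos (N%:CA - a) by apply: pos_sub_sa => //; rewrite /N; lra.
have paN : pos (a - (- N)%:CA).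
  rewrite crealN opprK addrC -[a]opprK; apply: pos_sub_sa => //.
    by rewrite starN sa.
  by rewrite nrmN /N; lra.
pose S := [set t | pos (q * (a - t%:CA))].
have SN : S (- N) by exact: posM.
have ubS t : S t -> t <= N.
  move=> St; rewrite leNgt; apply/negP => Nt; apply: qn0.
  apply: pos_anti => //; apply: (@posZV _ _ (t - N)); first by rewrite subr_gt0.
  have -> : (t - N)%:CA * - q = q * (a - t%:CA) + q * (N%:CA - a).
    by rewrite crealD crealN; ring.
  by apply: posD => //; apply: posM.
have hs : has_sup S by split; [exists (- N) | exists N].
set T := sup S; have [e e0 he] := hq T.
(* The 1 in [L] keeps [L - N + t] nonnegative, since t > T - 1 >= - N - 1. The choice of [D] yields
   s L + s^2 < e, i.e. [s < k], so that [t + k] exceeds [T]. *)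
pose L := 2 * N + 1; have L0 : 0 < L by rewrite /L; lra.
have TN : - N <= T by apply: sup_ubound => //; case: hs.
pose D := Num.min 1 (e / (L + 1)).
have D0 : 0 < D by rewrite lt_min ltr01 divr_gt0 //; lra.
have [t St Tt] := sup_adherent D0 hs; rewrite -/T in Tt.
have tT : t <= T by apply: sup_ubound => //; case: hs.
pose s := T - t.
have sD : s < D by rewrite /s; lra.
move: (sD); rewrite lt_min ltr_pdivlMr; last lra.
move=> /andP[sD1 sDe].
have s0 : 0 <= s by rewrite /s; lra.
pose k := (e - s * s) / L.
suff Sk : S (t + k).
  have : t + k <= T by apply: sup_ubound => //; case: hs.
  have : s < k by rewrite /k ltr_pdivlMr //; nra.
  rewrite /s; lra.
have kE : L%:CA * k%:CA = e%:CA - s%:CA * s%:CA.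
  by rewrite -!crealM -crealN -crealD /k mulrC divfK ?gt_eqF.
have TE : T%:CA = t%:CA + s%:CA by rewrite -crealD /s addrC subrK.
apply: (@posZV _ _ L) => //.
(* Combines (a - t)^2 = (a - T)^2 + 2 s (a - t) - s^2 with L (a - t) = (a - t) (L - (a - t)) + (a -
   t)^2. *)
have -> : L%:CA * (q * (a - (t + k)%:CA)) =
   q * (a - t%:CA) * ((N%:CA - a) + (L - N + t)%:CA) +
   q * ((a - T%:CA) * (a - T%:CA) - e%:CA) + (s + s)%:CA * (q * (a - t%:CA)).
  transitivity (L%:CA * (q * (a - t%:CA)) - q * (L%:CA * k%:CA)).
    by rewrite (crealD A t k); ring.
  rewrite kE TE (crealD A (L - N) t) (crealD A L (- N)) crealN (crealD A s s).
  by ring.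
apply: posD; last by apply: posZ => //; lra.
apply: posD => //; apply: posM => //; apply: posD => //; apply: pos_creal.
rewrite /L; move: Tt; have : D <= 1 by rewrite ge_min lexx.
lra.
Qed.

(* Writing a - t = u^2 - v^2 with u v = 0, d a = 2 u (d u) - 2 v (d v) is
   controlled by |a - t| = u^2 + v^2, i.e. d a vanishes where a = t. *)
Lemma derivation_local_bound (d : A -> A) : linear d ->
  (forall x y, d (x * y) = d x * y + x * d y) ->
  forall a t, star a = a -> exists2 r, 0 < r & exists2 w, pos w &
   w * w = (a - t%:CA) * (a - t%:CA) /\ pos (r%:CA * w - d a * star (d a)).
Proof.
move=> dl dM a t sa.
have dD x y : d (x + y) = d x + d y by have := dl 1 x y; rewrite !scale1r.
have d0 : d 0 = 0 by apply: (addrI (d 0)); rewrite -dD !addr0.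
have dN x : d (- x) = - d x.
  by apply: (addrI (d x)); rewrite -dD !subrr.
have d1 : d 1 = 0.
  have := dM 1 1; rewrite !mulr1 mul1r => /(congr1 (fun z => z - d 1)).
  by rewrite addrK subrr.
have dt : d t%:CA = 0.
  by have := dl t%:C 1 0; rewrite d1 d0 !addr0 scaler0.
have [u [v [su sv uv aE]]] : exists u v, [/\ star u = u, star v = v, u * v = 0
    & a - t%:CA = u * u - v * v].
  by apply: jordan_dec; rewrite starB sa star_creal.
have daE : d a = u * d u + u * d u - (v * d v + v * d v).
  have -> : d a = d (a - t%:CA) by rewrite dD dN dt subr0.
  by rewrite aE dD dN !dM; ring.
pose f x := (d x + d x) * star (d x + d x).
(* This [r] makes [r - f u] and [r - f v] positive; the cross terms of [d a * star (d a)] vanish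
   with [u * v]. *)
pose r := 1 + nrm (f u) + nrm (f v).
have fu0 := nrm_ge0 (f u); have fv0 := nrm_ge0 (f v).
have r0 : 0 < r by rewrite /r; lra.
have pf x : nrm (f x) <= r -> pos (r%:CA - f x).
  by apply: pos_sub_sa => //; apply/pos_sa/pos_mul_star.
exists r => //; exists (u * u + v * v).
  by apply: posD; [exists u | exists v].
split.
  transitivity ((u * u - v * v) * (u * u - v * v) +
    (u * v) * (u * v + u * v + (u * v + u * v))).
    by ring.
  by rewrite uv mul0r addr0 aE.
have -> : r%:CA * (u * u + v * v) - d a * star (d a) =
    u * u * (r%:CA - f u) + v * v * (r%:CA - f v).
  rewrite daE /f !(starB, starD, starMr) su sv.
  set du := d u; set dv := d v.
  transitivity (u * u * (r%:CA - (du + du) * (star du + star du)) +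
    v * v * (r%:CA - (dv + dv) * (star dv + star dv)) +
    u * v * ((du + du) * (star dv + star dv) + (dv + dv) * (star du + star du))).
    by ring.
  by rewrite uv mul0r addr0.
apply: posD; apply: posM.
- by exists u.
- by apply: pf; rewrite /r; lra.
- by exists v.
- by apply: pf; rewrite /r; lra.
Qed.

(** For self-adjoint [a] and [b = d a], let [q] be the positive part of [b * star b - e]. Where [q]
    lives, |b|^2 >= e, so [derivation_local_bound] keeps |a - t| above [e / r], with [r] depending
    on [t]. Then [empty_local_spectrum] gives [q = 0], for every [e]. Real and imaginary parts give
    the general case. *)
Lemma commutative_derivation_eq0 (d : A -> A) : linear d ->
  (forall x y, d (x * y) = d x * y + x * d y) -> forall a, d a = 0.
Proof.
move=> dl dM.
have dD x y : d (x + y) = d x + d y by have := dl 1 x y; rewrite !scale1r.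
have d0 : d 0 = 0 by apply: (addrI (d 0)); rewrite -dD !addr0.
have dZ z x : d (z *: x) = z *: d x by have := dl z x 0; rewrite d0 !addr0.
have dsa a : star a = a -> d a = 0.
  move=> sa; set b := d a.
  suff : b * star b = 0.
    move=> bb; apply: nrm_eq0; have := nrm_star b; rewrite mulrC bb nrm0 => h.
    by apply/eqP; rewrite -sqrf_eq0 -h.
  apply: pos_eq0_of_le => [|e e0]; first exact: pos_mul_star.
  have [p [m [sp sm pm pmE]]] : exists p m, [/\ star p = p, star m = m, p * m = 0
      & b * star b - e%:CA = p * p - m * m].
    apply: jordan_dec; rewrite starB star_creal (pos_sa (pos_mul_star b)) //.
  pose q := p * p.
  have q0 : pos q by exists p.
  have qb : pos (q * (b * star b - e%:CA)).
    rewrite pmE; have -> : q * (p * p - m * m) = q * q - (p * m) * (p * m).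
      by rewrite /q; ring.
    by rewrite pm mul0r subr0; apply: posM.
  have q00 : q = 0.
    apply: (empty_local_spectrum sa q0) => t.
    have [r r0 [w pw [wE hw]]] := derivation_local_bound dl dM t sa.
    have k0 : 0 < e / r by rewrite divr_gt0.
    have qw : pos (q * (w - (e / r)%:CA)).
      apply: (@posZV _ _ r) => //.
      have -> : r%:CA * (q * (w - (e / r)%:CA)) =
         q * (r%:CA * w - b * star b) + q * (b * star b - e%:CA).
        transitivity (q * (r%:CA * w) - q * (r%:CA * (e / r)%:CA)); first by ring.
        by rewrite -crealM [r * _]mulrC divfK ?gt_eqF //; ring.
      by apply: posD => //; apply: posM.
    exists (e / r * (e / r)); first by rewrite mulr_gt0.
    rewrite -wE.
    have -> : q * (w * w - (e / r * (e / r))%:CA) =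
       q * (w - (e / r)%:CA) * w + (e / r)%:CA * (q * (w - (e / r)%:CA)).
      by rewrite crealM; ring.
    by apply: posD; [exact: posM | exact: posZ (ltW _) _].
  have -> : e%:CA - b * star b = m * m.
    by rewrite -opprB pmE -/q q00 sub0r opprK.
  by exists m.
move=> a; have sj := star_cimag A; have jj := cimag_sqr A; set j := cimag A in sj jj.
have -> : a = (1/2)%:CA * (a + star a) - (1/2)%:CA * (j * (j * (a - star a))).
  rewrite [j * (j * _)]mulrA jj; transitivity (((1/2)%:CA + (1/2)%:CA) * a).
    by rewrite creal_half mul1r.
  by ring.
have d1 : d (a + star a) = 0 by apply: dsa; rewrite starD starK addrC.
have d2 : d (j * (a - star a)) = 0.
  by apply: dsa; rewrite starMr starB starK sj; ring.
rewrite -[(1/2)%:CA * (j * _)]scalecE -[(1/2)%:CA * (a + _)]scalecE.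
rewrite -[j * (j * _)]scalecE.
by rewrite scalerA -scaleNr dD !dZ d1 d2 !scaler0 addr0.
Qed.

End CommutativeDerivation.

(** * Full Hilbert modules *)

Section Neumann.
Variables (R : realType) (A : comCStarAlgType R).
Implicit Types (s x y : A).

(** Neumann series: [u] runs through the partial sums of the powers of [1 - s], dominated by a
    geometric series. *)
Lemma near1_invertible s : nrm (1 - s) < 1 -> exists y, s * y = 1.
Proof.
set x := 1 - s => x1; have x0 := nrm_ge0 x.
pose F y := 1 + x * y; pose f (r : R) := 1 + nrm x * r.
pose u n := iter n F 0; pose v n := iter n f 0.
have vl n : v n <= (1 - nrm x)^-1.
  have l0 : 0 < 1 - nrm x by lra.
  elim: n => [|n IH]; first by rewrite /= invr_ge0 ltW.
  rewrite -[v n.+1]/(1 + nrm x * v n).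
  have := ler_wpM2l x0 IH; have : (1 - nrm x) * (1 - nrm x)^-1 = 1.
    by rewrite mulfV // gt_eqF.
  lra.
have step n : nrm (u n.+1 - u n) <= v n.+1 - v n.
  elim: n => [|n IH].
    by rewrite /= /F /f !mulr0 !addr0 !subr0 nrm1_le.
  have -> : u n.+2 - u n.+1 = x * (u n.+1 - u n).
    by rewrite -[LHS]/(F (u n.+1) - F (u n)) /F; ring.
  have -> : v n.+2 - v n.+1 = nrm x * (v n.+1 - v n).
    by rewrite -[LHS]/(f (v n.+1) - f (v n)) /f; ring.
  exact: le_trans (nrmM _ _) (ler_wpM2l x0 IH).
have [y uy] := majorant_cvg step vl.
exists y; apply/eqP; rewrite -subr_eq0; apply/eqP/nrm_eq0/eqP.
rewrite eq_le nrm_ge0 andbT; apply/ler_addgt0Pr => e e0.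
have [N hN] := uy (e / 2) ltac:(lra).
have -> : s * y - 1 = x * (u N - y) - (u N.+1 - y).
  by rewrite -[u N.+1]/(F (u N)) /F /x; ring.
have := nrmD (x * (u N - y)) (- (u N.+1 - y)); rewrite nrmN.
have := nrmM x (u N - y); have := nrm_ge0 (u N - y).
have := hN N (leqnn N); have := hN N.+1 (leqnSn N).
nra.
Qed.

End Neumann.

(** * Adjointable operators of rank one and the action of A *)

Section HilbertModule.
Variables (R : realType) (A : comCStarAlgType R) (M : hilbertModType A).
Implicit Types (a b : A) (x y z w : M) (T D E : adjEnd M).

Local Notation "'<| x , y |>" := (hmip x y : A).

Lemma hmip_sumr n x (y : 'I_n -> M) :
  '<| x, \sum_i y i |> = \sum_i '<| x, y i |>.
Proof.
by apply: (big_morph (fun y => '<| x, y |>)) => [y1 y2|]; rewrite ?hmipDr //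
  hmip_star hmip0l star0.
Qed.

Lemma hmipNl x y : '<| - x, y |> = - '<| x, y |>.
Proof. by rewrite -scaleN1r hmipZl scaleN1r. Qed.

Lemma hmipNr x y : '<| x, - y |> = - '<| x, y |>.
Proof. by rewrite hmip_star hmipNl starN -hmip_star. Qed.

Lemma hmip_actl a x y : '<| hmact a x, y |> = a * '<| x, y |>.
Proof. exact: hmip_act. Qed.

Lemma hmip_actr a x y : '<| x, hmact a y |> = star a * '<| x, y |>.
Proof. by rewrite hmip_star hmip_actl starMr -hmip_star. Qed.

Lemma hmact_suml n (a : 'I_n -> A) x :
  hmact (\sum_i a i : A) x = \sum_i hmact (a i) x.
Proof.
apply: (big_morph (fun a : A => hmact a x)) => [a1 a2|]; first exact: hmactDl.
by have := hmactZl 0 (0 : A) x; rewrite !scale0r.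
Qed.

Lemma adjEnd_exists_adj T :
  exists S : M -> M, forall x y, '<| T x, y |> = '<| x, S y |>.
Proof. exact/adjointableP/valP. Qed.

Definition adj T : M -> M := projT1 (cid (adjEnd_exists_adj T)).

Lemma adjE T x y : '<| T x, y |> = '<| x, adj T y |>.
Proof. exact: (projT2 (cid (adjEnd_exists_adj T))). Qed.

Lemma adjEnd_act T a x : T (hmact a x) = hmact a (T x).
Proof. by apply: (@hmip_injl _ A) => z; rewrite adjE !hmip_actl adjE. Qed.

Lemma adjEnd_funN T x : (- T) x = - T x.
Proof. by []. Qed.

Lemma adjEnd_add T x y : T (x + y) = T x + T y.
Proof. by have := adjEnd_linear T 1 x y; rewrite !scale1r. Qed.

Lemma adjEnd_sum T n (x : 'I_n -> M) : T (\sum_i x i) = \sum_i T (x i).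
Proof.
apply: (big_morph T); first exact: adjEnd_add.
by apply: (addrI (T 0)); rewrite -adjEnd_add !addr0.
Qed.

Lemma adjEnd_opp T x : T (- x) = - T x.
Proof.
have T0 : T 0 = 0 by apply: (addrI (T 0)); rewrite -adjEnd_add !addr0.
by apply: (addrI (T x)); rewrite -adjEnd_add !subrr.
Qed.

Lemma rank1_subproof x y : (fun z => hmact '<| z, y |> x) \in adjointable M.
Proof.
apply/adjointableP; exists (fun v => hmact '<| v, x |> y) => z v.
by rewrite hmip_actl hmip_actr -hmip_star mulrC.
Qed.

Definition rank1 x y : adjEnd M := AdjEnd (rank1_subproof x y).

Lemma rank1E x y z : rank1 x y z = hmact '<| z, y |> x.
Proof. by []. Qed.

Lemma hmact_subproof a : (hmact a : M -> M) \in adjointable M.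
Proof.
apply/adjointableP; exists (hmact (star a)) => x y.
by rewrite hmip_actl hmip_actr starK.
Qed.

Definition act a : adjEnd M := AdjEnd (hmact_subproof a).

Lemma actE a x : act a x = hmact a x. Proof. by []. Qed.

Lemma adjEnd_mul_rank1 T x y : T * rank1 x y = rank1 (T x) y.
Proof. by apply: adjEndP => z; rewrite adjEnd_funM !rank1E adjEnd_act. Qed.

Lemma hmact_eq0_of_sqr a x : a * '<| x, x |> = 0 -> hmact a x = 0.
Proof.
move=> ax; apply: (@hmip_eq0 _ A).
by rewrite hmip_actl hmip_actr mulrCA ax mulr0.
Qed.

(** Test with E = theta_{x,Tx}: pairing T E T x = <Tx,Tx> Tx with [T x] gives <Tx,Tx>^2 = 0, and [A]
    is reduced. *)
Lemma adjEnd_semiprime T : (forall E, T * E * T = 0) -> T = 0.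
Proof.
move=> h; apply: adjEndP => x.
have /(congr1 (fun S : adjEnd M => S x)) := h (rank1 x (T x)).
rewrite !adjEnd_funM rank1E adjEnd_act => /= /(congr1 (fun z => '<| z, T x |>)).
rewrite hmip_actl hmip0l => /reduced; exact: hmip_eq0.
Qed.

Lemma adjEnd_torsion2 T : T + T = 0 -> T = 0.
Proof.
move=> TT; have : (2 : R[i]) *: T = 0 by rewrite scaler_nat mulr2n.
move=> /(congr1 (fun S => 2^-1 *: S)).
by rewrite scalerA mulVf ?pnatr_eq0 // scale1r scaler0.
Qed.

(* The module analogue of the identity tr (E a p) = tr (a E p) for p of rank
   one commuting with E; it makes tr (D a p) - tr (a D p) depend on D only
   through its commutator with p. *)
Lemma rank1_comm_trace E T x y : E * rank1 x y = rank1 x y * E ->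
  '<| E (T x), y |> = '<| T (E x), y |>.
Proof.
move=> cE.
have F w z : '<| E w, y |> * '<| x, z |> = '<| w, y |> * '<| E x, z |>.
  have /(congr1 (fun S : adjEnd M => '<| S w, z |>)) := cE.
  by rewrite !adjEnd_funM !rank1E adjEnd_act !hmip_actl.
have h1 := F (T x) x; have h2 := F y (adj T y); have h3 := F y x.
rewrite -!adjE in h2.
set f := '<| E (T x), y |> in h1 *; set h := '<| T (E x), y |> in h2 *.
set xx := '<| x, x |> in h1 h3; set yy := '<| y, y |> in h2 h3.
set t := '<| T x, y |> in h1 h2.
(* Three instances of [F] give this. As [f - h] is an inner product with [x] on the left and also
   one with [y] on the right, [hmact_eq0_of_sqr] removes [xx] and then [yy], at the cost of further
   factors [s] or [star s]. *)
have sxy : yy * (f - h) * xx = 0.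
  transitivity (yy * (f * xx) - (yy * h) * xx); first by ring.
  rewrite h1 -h2.
  transitivity (t * (yy * '<| E x, x |> - '<| E y, y |> * xx)); first by ring.
  by rewrite h3 subrr mulr0.
have sE : f - h = '<| x, adj T (adj E y) - adj E (adj T y) |>.
  by rewrite hmipDr hmipNr -!adjE.
set s := f - h in sxy sE *.
have sy : s * s * yy = 0.
  transitivity ('<| hmact (yy * s) x, adj T (adj E y) - adj E (adj T y) |>).
    by rewrite hmip_actl -sE; ring.
  by rewrite hmact_eq0_of_sqr ?hmip0l.
have s0 : (star (s * s)) * s = 0.
  rewrite {3}/s /f /h -hmipNl -hmipDl -hmip_actr.
  by rewrite hmact_eq0_of_sqr // hmip_star hmip0l star0.
have : star s * s = 0.
  apply: reduced; rewrite starMr in s0.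
  transitivity ((star s * star s * s) * s); first by ring.
  by rewrite s0 mul0r.
move=> ss; apply/eqP; rewrite -subr_eq0 -/f -/h -/s; apply/eqP/nrm_eq0/eqP.
by have := nrm_star s; rewrite ss nrm0 => h0; rewrite -sqrf_eq0 -h0.
Qed.

(** Some finite combination of inner products is at distance less than 1 from the unit, hence
    invertible; its inverse and the coefficients are absorbed into the left vectors. *)
Lemma full_frame : hilbert_full M -> exists n (x y : 'I_n -> M),
  \sum_i '<| x i, y i |> = 1.
Proof.
move=> hM.
have : (setT : set A) 1 by [].
rewrite -hM => /(_ (ball (1 : A) 1) (nbhsx_ballx _ _ ltr01)).
move=> [s [[n [c [x [y sE]]]]]].
rewrite -ball_normE /ball_ /= nrmE -[X in _ < X]/(1%:C) ltcR => /near1_invertible[b sb].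
exists n, (fun i => hmact b (c i *: x i)), y.
rewrite -sb sE mulr_suml; apply: eq_bigr => i _.
by rewrite hmip_actl hmipZl mulrC.
Qed.

(** * Frames, the centre of End*(M), and innerness of derivations *)

Section Frame.
Variables (n : nat) (X Y : 'I_n -> M).
Hypothesis frame : \sum_i '<| X i, Y i |> = 1.

Lemma frame_expand z : z = \sum_i rank1 z (Y i) (X i).
Proof.
by rewrite -[LHS](@hmact1 R A) -frame hmact_suml.
Qed.

(** Apply [T] to [frame_expand] and move it past each theta_{z,Y_i}. *)
Lemma adjEnd_central T : (forall E, T * E = E * T) ->
  T = act (\sum_i '<| T (X i), Y i |>).
Proof.
move=> cT; apply: adjEndP => z.
rewrite {1}(frame_expand z) adjEnd_sum actE hmact_suml; apply: eq_bigr => i _.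
by rewrite -adjEnd_funM cT.
Qed.

(** A derivation preserves the centre, so it induces a derivation [e] of [A], which vanishes. *)
Lemma derivation_act (d : adjEnd M -> adjEnd M) a : is_derivation d -> d (act a) = 0.
Proof.
move=> [dl dM].
have comm_act b T : act b * T = T * act b.
  by apply: adjEndP => z; rewrite !adjEnd_funM !actE adjEnd_act.
have dc b T : d (act b) * T = T * d (act b).
  have := dM (act b) T; rewrite comm_act dM comm_act addrC.
  by move=> /addIr.
pose e b := \sum_i '<| d (act b) (X i), Y i |>.
have eE b : d (act b) = act (e b) by apply: adjEnd_central.
suff e0 : e a = 0.
  rewrite eE e0; apply: adjEndP => z; rewrite actE.
  by have := hmactZl 0 (0 : A) z; rewrite !scale0r.
apply: commutative_derivation_eq0.
- move=> k b c; rewrite /e.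
  have -> : act (k *: b + c) = k *: act b + act c.
    by apply: adjEndP => z; rewrite actE hmactDl hmactZl.
  rewrite dl scaler_sumr -big_split; apply: eq_bigr => i _.
  by rewrite adjEnd_funD adjEnd_funZ hmipDl hmipZl.
- move=> b c.
  have -> : e (b * c) = \sum_i '<| d (act b * act c) (X i), Y i |>.
    apply: eq_bigr => i _; congr '<| d _ _, _ |>.
    by apply: adjEndP => z; rewrite actE hmactM.
  rewrite dM [d (act b) * _]dc /e mulr_suml mulr_sumr -big_split; apply: eq_bigr => i _.
  by rewrite adjEnd_funD hmipDl !adjEnd_funM !actE !hmip_actl [c * _]mulrC.
Qed.

Lemma derivation_inner (d : adjEnd M -> adjEnd M) : is_derivation d ->
  exists D, forall T, d T = D * T - T * D.
Proof.
move=> hd; have [dl dM] := hd.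
pose D z := \sum_i d (rank1 z (Y i)) (X i).
have DT T z : D (T z) = d T z + T (D z).
  rewrite /D adjEnd_sum {2}(frame_expand z) adjEnd_sum -big_split.
  apply: eq_bigr => i _.
  by rewrite -adjEnd_mul_rank1 dM adjEnd_funD !adjEnd_funM.
have Da a z : D (hmact a z) = hmact a (D z).
  by rewrite -actE DT derivation_act // add0r.
have Dadj : D \in adjointable M.
  apply/adjointableP.
  (* [P w i] is theta_{X_i,w} composed with [D], that is, u maps to <Du,w> X_i, written so as to be
     adjointable before [D] is known to be. *)
  pose P w i := rank1 (D (X i)) w - d (rank1 (X i) w).
  exists (fun w => \sum_i adj (P w i) (Y i)) => u w.
  rewrite hmip_sumr -[LHS]mulr1 -frame mulr_sumr; apply: eq_bigr => i _.
  rewrite -adjE -hmip_actl; congr '<| _, _ |>.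
  rewrite /P adjEnd_funD adjEnd_funN (rank1E (D (X i))) -Da -(rank1E (X i) w u) DT.
  by rewrite addrAC subrr add0r rank1E.
exists (AdjEnd Dadj) => T; apply: adjEndP => z.
by rewrite adjEnd_funD adjEnd_funN !adjEnd_funM /= DT addrK.
Qed.

End Frame.
End HilbertModule.

(** * Jordan derivations of semiprime rings *)

Section JordanDerivation.
Import -(notations) Ncring Ncring_tac.
Variable B : pzRingType.
Implicit Types (a b c u x y z : B).

#[local] Instance pzRing_ncring_ops :
  @Ring_ops B 0 1 +%R *%R (fun x y => x - y) -%R eq := {}.

#[local] Instance pzRing_ncring : Ring (Ro := pzRing_ncring_ops).
Proof.
split; rewrite /equality /addition /multiplication /opposite /zero /one
  /subtraction /eq_notation /add_notation /zero_notation /mul_notation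
  /one_notation /opp_notation /sub_notation /=;
  try (by move=> ? ? -> ? ? ->); try (by move=> ? ? ->).
- by split; [move=> ? | move=> ? ? -> | move=> ? ? ? -> ->].
- exact: add0r.
- exact: addrC.
- exact: addrA.
- exact: mul1r.
- exact: mulr1.
- exact: mulrA.
- exact: mulrDl.
- by move=> x y z; rewrite mulrDr.
- by [].
- exact: subrr.
Qed.

Hypothesis torsion2 : forall x, x + x = 0 -> x = 0.
Hypothesis semiprime : forall z, (forall x, z * x * z = 0) -> z = 0.

Variable delta : B -> B.
Hypothesis deltaD : {morph delta : x y / x + y}.
Hypothesis delta_sqr : forall x, delta (x * x) = delta x * x + x * delta x.
Hypothesis delta_central : forall z c, (forall x, z * x = x * z) ->
  delta (z * c) = z * delta c.

Let delta0 : delta 0 = 0.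
Proof. by apply: (addrI (delta 0)); rewrite -deltaD !addr0. Qed.

Let deltaN x : delta (- x) = - delta x.
Proof. by apply: (addrI (delta x)); rewrite -deltaD !subrr. Qed.

Let double_inj x y : x + x = y + y -> x = y.
Proof.
move=> xy; apply/eqP; rewrite -subr_eq0; apply/eqP/torsion2.
by rewrite addrACA xy -opprD subrr.
Qed.

Let delta_jordan x y :
  delta (x * y + y * x) = delta x * y + x * delta y + delta y * x + y * delta x.
Proof.
have -> : x * y + y * x = (x + y) * (x + y) + - (x * x) + - (y * y).
  by non_commutative_ring.
rewrite !deltaD !deltaN !delta_sqr !deltaD; non_commutative_ring.
Qed.

(** Twice xyx is a combination of Jordan products of [x], [y] and squares of [x]. *)
Let delta_triple x y :
  delta (x * y * x) = delta x * y * x + x * delta y * x + x * y * delta x.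
Proof.
apply: double_inj; rewrite -deltaD.
have -> : x * y * x + x * y * x =
    (x * (x * y + y * x) + (x * y + y * x) * x) + - ((x * x) * y + y * (x * x)).
  by non_commutative_ring.
rewrite deltaD deltaN !delta_jordan delta_sqr; non_commutative_ring.
Qed.

Let delta_triple2 x y z : delta (x * y * z + z * y * x) =
  delta x * y * z + x * delta y * z + x * y * delta z +
  delta z * y * x + z * delta y * x + z * y * delta x.
Proof.
have -> : x * y * z + z * y * x =
    (x + z) * y * (x + z) + - (x * y * x) + - (z * y * z).
  by non_commutative_ring.
rewrite !deltaD !deltaN !delta_triple deltaD; non_commutative_ring.
Qed.

Let comm x y := x * y - y * x.
Let defect x y := delta (x * y) - delta x * y - x * delta y.

Let defectC x y : defect y x = - defect x y.
Proof.
rewrite /defect; have -> : y * x = (x * y + y * x) + - (x * y).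
  by non_commutative_ring.
rewrite deltaD deltaN delta_jordan; non_commutative_ring.
Qed.

Let defectDl x y z : defect (x + y) z = defect x z + defect y z.
Proof. rewrite /defect mulrDl !deltaD; non_commutative_ring. Qed.

Let defectDr x y z : defect x (y + z) = defect x y + defect x z.
Proof. rewrite /defect mulrDr !deltaD; non_commutative_ring. Qed.

Let commDl x y z : comm (x + y) z = comm x z + comm y z.
Proof. rewrite /comm; non_commutative_ring. Qed.

Let commDr x y z : comm x (y + z) = comm x y + comm x z.
Proof. rewrite /comm; non_commutative_ring. Qed.

Let mulr_bilin x y z u v :
  (x + y) * z * (u + v) = x * z * u + y * z * v + (x * z * v + y * z * u).
Proof. non_commutative_ring. Qed.

(* Expand delta (abxba + baxab) in two ways. *)
Let defect_comm x y u : defect x y * u * comm x y = - (comm x y * u * defect x y).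
Proof.
have h1 := delta_triple2 (x * y) u (y * x).
have h2 : delta (x * y * u * (y * x) + y * x * u * (x * y)) =
    delta x * (y * u * y) * x +
      x * (delta y * u * y + y * delta u * y + y * u * delta y) * x
      + x * (y * u * y) * delta x +
    (delta y * (x * u * x) * y +
      y * (delta x * u * x + x * delta u * x + x * u * delta x) * y
      + y * (x * u * x) * delta y).
  have -> : x * y * u * (y * x) + y * x * u * (x * y) =
      x * (y * u * y) * x + y * (x * u * x) * y by non_commutative_ring.
  by rewrite deltaD !delta_triple.
have dyx : delta (y * x) = delta y * x + y * delta x - defect x y.
  by rewrite -defectC /defect; non_commutative_ring.
have dxy : delta (x * y) = delta x * y + x * delta y + defect x y.
  by rewrite /defect; non_commutative_ring.
apply/eqP; rewrite -subr_eq0 opprK; apply/eqP.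
rewrite h2 dxy dyx in h1.
move/eqP: h1; rewrite -subr_eq0 => /eqP h1.
rewrite -[RHS]h1 /comm; set D := defect x y; non_commutative_ring.
Qed.

(** With G the defect and C the commutator, exchanging them by [defect_comm] shows that (G u C) z (G
    u C) equals its own opposite. *)
Let defect_comm0 x y u : defect x y * u * comm x y = 0.
Proof.
apply: semiprime => z; set G := defect x y; set C := comm x y.
have F v : G * v * C = - (C * v * G) := defect_comm x y v.
have F' v : C * v * G = - (G * v * C) by rewrite F opprK.
apply: torsion2.
have E1 : G * u * C * z * (G * u * C) = - (G * (u * G * z) * C * u * C).
  transitivity (G * u * (C * z * G) * u * C); first by non_commutative_ring.
  by rewrite F'; non_commutative_ring.
have E2 : G * (u * G * z) * C * u * C = G * u * C * z * (G * u * C).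
  rewrite F; transitivity (- (C * u * G * z * (G * u * C))).
    by non_commutative_ring.
  by rewrite F'; non_commutative_ring.
by rewrite {1}E1 E2 addNr.
Qed.

(** Linearise [defect_comm0] in [x]: the resulting exchange puts [comm x y] to the right of
    [defect x y] in the product required by semiprimeness. The next lemma does the same in the
    second variable. *)
Let defect_comm1 x y z u : defect x y * u * comm z y = 0.
Proof.
have E v : defect x y * v * comm z y = - (defect z y * v * comm x y).
  apply/eqP; rewrite -subr_eq0 opprK; apply/eqP.
  have := defect_comm0 (x + z) y v; rewrite defectDl commDl mulr_bilin.
  by rewrite !defect_comm0 add0r add0r.
apply: semiprime => v.
rewrite {2}E; transitivity (- (defect x y * (u * comm z y * v * defect z y * u) *
  comm x y)).
  by non_commutative_ring.
by rewrite defect_comm0 oppr0.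
Qed.

Let defect_comm2 x y z w u : defect x y * u * comm z w = 0.
Proof.
have E v : defect x y * v * comm z w = - (defect x w * v * comm z y).
  apply/eqP; rewrite -subr_eq0 opprK; apply/eqP.
  have := defect_comm1 x (y + w) z v; rewrite defectDr commDr mulr_bilin.
  by rewrite !defect_comm1 add0r add0r.
apply: semiprime => v.
rewrite {2}E; transitivity (- (defect x y * (u * comm z w * v * defect x w * u) *
  comm z y)).
  by non_commutative_ring.
by rewrite defect_comm1 oppr0.
Qed.

Let defect_central x y z : defect x y * z = z * defect x y.
Proof.
apply/eqP; rewrite -subr_eq0; apply/eqP/semiprime => u.
set G := defect x y.
transitivity (G * (z * u) * comm G z - z * (G * u * comm G z)).
  by rewrite /comm; non_commutative_ring.
by rewrite !defect_comm2 mulr0 subrr.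
Qed.

(** The defect G is central and kills commutators. As 2 G = delta [x,y] - [delta x, y] -
    [x, delta y], it follows that 2 G^2 = G delta [x,y] = delta (G [x,y]) = 0, and semiprimeness
    gives G = 0. *)
Lemma jordan_derivationM x y : delta (x * y) = delta x * y + x * delta y.
Proof.
suff : defect x y = 0.
  move=> h; apply/eqP; rewrite -subr_eq0; apply/eqP.
  by rewrite -[RHS]h /defect; non_commutative_ring.
set G := defect x y.
have G0 v w : G * comm v w = 0 by rewrite -[G]mulr1 defect_comm2.
have GG : G * G = 0.
  apply: torsion2.
  have -> : G * G + G * G =
      G * (delta (comm x y) - comm (delta x) y - comm x (delta y)).
    transitivity (G * (defect x y - defect y x)).
      by rewrite (defectC x y) -/G; non_commutative_ring.
    by rewrite /comm deltaD deltaN /defect; non_commutative_ring.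
  transitivity (G * delta (comm x y) - G * comm (delta x) y - G * comm x (delta y)).
    by non_commutative_ring.
  rewrite !G0 !subr0 -delta_central ?G0 ?delta0 //.
  by move=> z; exact: defect_central.
apply: semiprime => z; rewrite defect_central -mulrA GG mulr0 //.
Qed.

End JordanDerivation.

(** * 2-local derivations of End*(M) *)

Theorem theorem3p3 (R : realType) (A : comCStarAlgType R)
    (M : hilbertModType A) (hM : hilbert_full M)
    (delta : adjEnd M -> adjEnd M) (hdelta : is_2local_derivation delta) :
  is_derivation delta.
Proof.
have [n [X [Y frame]]] := full_frame hM.
have inner a b : exists D : adjEnd M,
    delta a = D * a - a * D /\ delta b = D * b - b * D.
  have [d [hd -> ->]] := hdelta a b.
  by have [D hD] := derivation_inner frame hd; exists D.
have deltaD : {morph delta : a b / a + b}.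
  move=> a b; apply: adjEndP => x; apply: (@hmip_injl _ A) => y.
  (* One D, implementing delta at the rank one operator, serves for all c. *)
  have [D [_ Dp]] := inner 0 (rank1 x y).
  have indep c : hmip (delta c x) y =
      hmip (D (c x)) y - hmip (c (D x)) y :> A.
    have [D' [-> D'p]] := inner c (rank1 x y).
    rewrite adjEnd_funD adjEnd_funN !adjEnd_funM hmipDl hmipNl.
    (* [D'] and [D] both implement [delta] at theta_{x,y}, so their difference commutes with it and
       [rank1_comm_trace] replaces [D'] by [D]. *)
    have cE : (D' - D) * rank1 x y = rank1 x y * (D' - D).
      apply/eqP; rewrite -subr_eq0 mulrBl mulrBr opprB [_ * D - _]addrC addrACA.
      by rewrite -D'p Dp [X in _ + X]addrC -[X in _ + X]opprB subrr.
    have := rank1_comm_trace c cE.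
    rewrite !adjEnd_funD !adjEnd_funN adjEnd_add adjEnd_opp !hmipDl !hmipNl => h.
    apply/eqP; rewrite -subr_eq0; apply/eqP.
    move/eqP: h; rewrite -subr_eq0 => /eqP h.
    by rewrite -[RHS]h; ring.
  by rewrite adjEnd_funD hmipDl !indep !adjEnd_funD adjEnd_add !hmipDl; ring.
have deltaZ k a : delta (k *: a) = k *: delta a.
  have [d [[dl _] -> ->]] := hdelta (k *: a) a.
  have d0 : d 0 = 0 by have := dl (-1) 0 0; rewrite scaler0 addr0 scaleN1r addNr.
  by have := dl k a 0; rewrite d0 !addr0.
split; first by move=> k a b; rewrite deltaD deltaZ.
apply: jordan_derivationM => //.
- exact: adjEnd_torsion2.
- exact: adjEnd_semiprime.
- move=> a; have [d [[_ dM] -> ->]] := hdelta (a * a) a; exact: dM.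
- move=> z c cz; have [D [-> ->]] := inner (z * c) c.
  by rewrite mulrBr !mulrA (cz D).
Qed.
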